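(* Let $L$ be a finite-dimensional Leibniz $A$-algebra over a field $F$. Then the lower nilpotent series of $L$ coincides with the derived series of $L$, that is, $N_i(L)=L^{(i)}$ for all $i\ge 0$.
   Context: A (right) Leibniz algebra over $F$ is a vector space with a bilinear product $[\,,]$ satisfying $[x,[y,z]]=[[x,y],z]-[[x,z],y]$ for all $x,y,z$. All algebras are finite-dimensional. Ideals are two-sided. Lower central series: $L^1=L$, $L^{k+1}=[L^k,L]$; $L$ is nilpotent if $L^{k}=0$ for some $k$ (equivalently, all products of sufficiently many elements vanish). Derived series: $L^{(0)}=L$, $L^{(k+1)}=[L^{(k)},L^{(k)}]$. $L$ is abelian if $[x,y]=0$ for all $x,y$. $L$ is an $A$-algebra if every nilpotent subalgebra of $L$ is abelian. The nilpotent residual $\gamma_\infty(L)$ is the smallest ideal of $L$ such that $L/\gamma_\infty(L)$ is nilpotent (it is the intersection of the terms of the lower central series). The lower nilpotent series is defined by $N_0(L)=L$, $N_{i+1}(L)=\gamma_\infty(N_i(L))$ for $i\ge 0$. *)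

(* Defs.v *)
From HB Require Import structures.
From mathcomp Require Import all_boot all_order all_algebra.
From mathcomp Require Import boolp classical_sets.

Set Implicit Arguments.
Unset Strict Implicit.
Unset Printing Implicit Defensive.

Import GRing.Theory.
Local Open Scope ring_scope.

(* A Leibniz algebra is a [vectType] L with a bilinear [br : L -> L -> L]
   satisfying [leibniz_identity]; its subalgebras and ideals are elements of
   [{vspace L}].  The notions below take a bare function [br], so that they also
   apply to the product of a quotient algebra; they are only meaningful when
   [br] is bilinear. *)

Section Definitions.
Variables (F : fieldType) (L : vectType F).
Implicit Types (br : L -> L -> L) (U V M J K : {vspace L}).

Definition leibniz_identity br : Prop :=
  forall x y z : L, br x (br y z) = br (br x y) z - br (br x z) y.

(* The span of all products br u v with u \in U and v \in V; bilinearity allows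
   to use bases of U and V only, see [brvP]. *)
Definition brv br U V : {vspace L} :=
  <<[seq br u v | u <- vbasis U, v <- vbasis V]>>%VS.

Definition subalgebra br M : Prop :=
  forall x y, x \in M -> y \in M -> br x y \in M.

Definition ideal_of br M J : Prop :=
  (J <= M)%VS /\
  forall x y, x \in M -> y \in J -> br x y \in J /\ br y x \in J.

(* [lcs br M k] is $M^{k+1}$. *)
Fixpoint lcs br M (k : nat) : {vspace L} :=
  if k is k'.+1 then brv br (lcs br M k') M else M.

Fixpoint derived_series br M (i : nat) : {vspace L} :=
  if i is i'.+1 then brv br (derived_series br M i') (derived_series br M i')
  else M.

Definition nilpotent br M : Prop := exists k, lcs br M k = 0%VS.

Definition abelian br M : Prop :=
  forall x y, x \in M -> y \in M -> br x y = 0.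

Definition A_algebra br : Prop :=
  forall M, subalgebra br M -> nilpotent br M -> abelian br M.

(* The quotient M / J is realised on the complement [(M :\: J)%VS] of J in M,
   which represents each coset once; the product of two cosets is represented by
   the projection, along J, of the product of their representatives. *)
Definition quo_br br M J : L -> L -> L := fun x y => addv_pi1 M J (br x y).

Definition nilpotent_quo br M J : Prop := nilpotent (quo_br br M J) (M :\: J)%VS.

Definition is_nilpotent_residual br M J : Prop :=
  [/\ ideal_of br M J, nilpotent_quo br M J &
      forall K, ideal_of br M K -> nilpotent_quo br M K -> (J <= K)%VS].

(* Existence for a subalgebra M of a Leibniz algebra is [nilpotent_residualP];
   the default value 0 is then irrelevant. *)
Definition nilpotent_residual br M : {vspace L} :=
  xget 0%VS [set J | is_nilpotent_residual br M J]%classic.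

Fixpoint lower_nilpotent_series br (i : nat) : {vspace L} :=
  if i is i'.+1 then nilpotent_residual br (lower_nilpotent_series br i')
  else fullv.

End Definitions.

Section Theory.
Variables (F : fieldType) (L : vectType F).
Implicit Types (U V W M J K : {vspace L}).

Section Product.
Variable br : {bilinear L -> L -> L}.

Lemma memv_brv U V u v : u \in U -> v \in V -> br u v \in brv br U V.
Proof.
move=> /coord_vbasis-> /coord_vbasis->.
rewrite linear_sumr; apply: memv_suml => i _.
rewrite linear_sumlz; apply: memv_suml => j _.
rewrite linearZl_LR linearZr_LR; do 2!apply: memvZ.
apply: memv_span; apply/allpairsP.
by exists ((vbasis U)`_j, (vbasis V)`_i); rewrite !mem_nth ?size_tuple.
Qed.

Lemma brvP U V W :
  (brv br U V <= W)%VS <-> (forall u v, u \in U -> v \in V -> br u v \in W).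
Proof.
split=> [/subvP sW u v Uu Vv | sW]; first exact/sW/memv_brv.
apply/span_subvP => _ /allpairsP[[u v] /= [Uu Vv ->]].
by apply: sW; apply: vbasis_mem.
Qed.

End Product.

Section Bilinear.
Variable br : {bilinear L -> L -> L}.

Lemma quo_br_bilinear M J : bilinear_for *:%R *:%R (quo_br br M J).
Proof.
by split=> w a u v; rewrite /quo_br ?linearPl ?linearPr linearP.
Qed.

HB.instance Definition _ M J :=
  bilinear_isBilinear.Build F L L L *:%R *:%R (quo_br br M J)
    (quo_br_bilinear M J).

Lemma addv_pi1_eq0 M J x : x \in J -> addv_pi1 M J x = 0.
Proof.
move=> Jx; have := @addv_pi1_pi2 _ _ M J x (subvP (addvSr M J) _ Jx).
by rewrite addv_pi2_id // => /(canRL (addrK _)); rewrite subrr.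
Qed.

Lemma addv_pi1_id M J x : x \in (M :\: J)%VS -> addv_pi1 M J x = x.
Proof. by apply: daddv_pi_id; rewrite capv_diff. Qed.

Lemma addv_pi1_congr M J x : x \in M -> x - addv_pi1 M J x \in J.
Proof.
move=> Mx; have := @addv_pi1_pi2 _ _ M J x (subvP (addvSl M J) _ Mx).
by move=> {1}<-; rewrite addrC addKr memv_pi2.
Qed.

Lemma lcs_sub M k : subalgebra br M -> (lcs br M k <= M)%VS.
Proof.
move=> sM; elim: k => //= k IH; apply/brvP => u v /(subvP IH) Mu Mv.
exact: sM.
Qed.

Lemma lcsS_sub M k : subalgebra br M -> (lcs br M k.+1 <= lcs br M k)%VS.
Proof.
move=> sM; elim: k => [|k IH]; first exact: (@lcs_sub M 1).
by apply/brvP => u v /(subvP IH) ku Mv; apply: memv_brv.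
Qed.

Lemma lcs_decr M k m :
  subalgebra br M -> (k <= m)%N -> (lcs br M m <= lcs br M k)%VS.
Proof.
move=> sM /subnK<-; elim: (m - k)%N => // d IH.
exact: subv_trans (lcsS_sub _ sM) IH.
Qed.

Lemma quo_br_pi M J x y : ideal_of br M J -> x \in M -> y \in M ->
  quo_br br M J (addv_pi1 M J x) (addv_pi1 M J y) = addv_pi1 M J (br x y).
Proof.
move=> [sJM iJ] Mx My; rewrite /quo_br.
set px := addv_pi1 M J x; set py := addv_pi1 M J y.
have Mpx : px \in M by apply: (subvP (diffvSl M J)); apply: memv_pi.
have E : br x y = br px py + (br (x - px) y + br px (y - py)).
  by rewrite linearBl linearBr /= addrC subrKA subrK.
rewrite E linearD /= [X in _ + X]addv_pi1_eq0 ?addr0 //.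
apply: rpredD; first by apply: (iJ y _ My _).2; apply: addv_pi1_congr.
by apply: (iJ px _ Mpx _).1; apply: addv_pi1_congr.
Qed.

Lemma lcs_quo M J k : subalgebra br M -> ideal_of br M J ->
  lcs (quo_br br M J) (M :\: J)%VS k = (addv_pi1 M J @: lcs br M k)%VS.
Proof.
move=> sM iJ.
have E0 : (M :\: J = addv_pi1 M J @: M)%VS.
  apply/eqP; rewrite eqEsubv; apply/andP; split; apply/subvP => x.
    move=> Qx; rewrite -(addv_pi1_id Qx); apply: memv_img.
    exact: (subvP (diffvSl M J)).
  by case/memv_imgP => y _ ->; apply: memv_pi.
elim: k => [//|k IH] /=; rewrite IH {1}E0.
apply/eqP; rewrite eqEsubv; apply/andP; split.
  apply/(brvP (quo_br br M J)) => _ _ /memv_imgP[u ku ->] /memv_imgP[v Mv ->].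
  rewrite /= quo_br_pi //; last exact: (subvP (lcs_sub k sM)).
  exact/memv_img/memv_brv.
suff /subvP h : (brv br (lcs br M k) M <= addv_pi1 M J @^-1: brv (quo_br br M J)
    (addv_pi1 M J @: lcs br M k) (addv_pi1 M J @: M))%VS.
  by apply/subvP => _ /memv_imgP[x /h hx ->]; rewrite memv_preim.
apply/brvP => u v ku Mv.
rewrite -memv_preim -(quo_br_pi iJ (subvP (lcs_sub k sM) _ ku) Mv).
by apply: (memv_brv (quo_br br M J)); apply: memv_img.
Qed.

Lemma nilpotent_quoP M J : subalgebra br M -> ideal_of br M J ->
  nilpotent_quo br M J <-> exists k, (lcs br M k <= J)%VS.
Proof.
move=> sM iJ; split=> -[k Ek]; exists k.
  apply/subvP => x kx; have Mx := subvP (lcs_sub k sM) _ kx.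
  have := memv_img (addv_pi1 M J) kx; rewrite -lcs_quo // Ek memv0 => /eqP px0.
  by have := addv_pi1_congr J Mx; rewrite px0 subr0.
apply/eqP; rewrite -subv0 lcs_quo //; apply/subvP => _ /memv_imgP[x kx ->].
by rewrite addv_pi1_eq0 ?mem0v //; apply: (subvP Ek).
Qed.

Hypothesis brL : leibniz_identity br.

Lemma brv_lcs M i j :
  (brv br (lcs br M i) (lcs br M j) <= lcs br M (i + j).+1)%VS.
Proof.
elim: j i => [|j IH] i; first by rewrite addn0.
apply/brvP => x w ix jw.
pose f := linfun (br x).
suff : (lcs br M j.+1 <= f @^-1: lcs br M (i + j.+1).+1)%VS.
  by move=> /subvP /(_ _ jw); rewrite -memv_preim lfunE.
apply/brvP => y z jy Mz; rewrite -memv_preim lfunE /= brL addnS.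
apply: rpredB; first by apply: memv_brv => //; apply: (subvP (IH i)); apply: memv_brv.
by have := subvP (IH i.+1) _ (memv_brv br (memv_brv br ix Mz) jy); rewrite addSn.
Qed.

Lemma lcs_ideal M k : subalgebra br M -> ideal_of br M (lcs br M k).
Proof.
move=> sM; split=> [|x y Mx ky]; first exact: lcs_sub.
split; apply: (subvP (lcsS_sub k sM)); last exact: memv_brv.
by apply: (subvP (@brv_lcs M 0 k)); apply: memv_brv.
Qed.

Lemma nilpotent_residual_exists M :
  subalgebra br M -> exists J, is_nilpotent_residual br M J.
Proof.
move=> sM; pose P d := `[< exists k, \dim (lcs br M k) = d >].
have exP : exists d, P d by exists (\dim M); apply/asboolP; exists 0.
case: (ex_minnP exP) => d /asboolP[k dk] dmin; exists (lcs br M k); split.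
- exact: lcs_ideal.
- by apply/nilpotent_quoP; [|exact: lcs_ideal|exists k].
move=> K iK /(nilpotent_quoP sM iK)[m mK].
suff -> : lcs br M k = lcs br M (maxn k m).
  by apply: subv_trans mK; apply: lcs_decr => //; apply: leq_maxr.
apply/esym/eqP; rewrite eqEdim lcs_decr ?leq_maxl //= dk dmin //.
by apply/asboolP; exists (maxn k m).
Qed.

Lemma nilpotent_residualP M : subalgebra br M ->
  is_nilpotent_residual br M (nilpotent_residual br M).
Proof. by move=> sM; apply: xgetPex; apply: nilpotent_residual_exists. Qed.

Lemma lower_nilpotent_series_subalgebra i :
  subalgebra br (lower_nilpotent_series br i).
Proof.
elim: i => [|i /nilpotent_residualP[[sJ iJ] _ _]] x y; first by rewrite !memvf.
by move=> /= Jx Jy; apply: (iJ x y _ Jy).1; apply: (subvP sJ).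
Qed.

Lemma lower_nilpotent_seriesP i :
  is_nilpotent_residual br (lower_nilpotent_series br i)
                           (lower_nilpotent_series br i.+1).
Proof. exact/nilpotent_residualP/lower_nilpotent_series_subalgebra. Qed.

End Bilinear.
End Theory.

(* Main.v *)
Require Import Defs.
From mathcomp Require Import all_boot all_order all_algebra.
From mathcomp Require Import boolp.

(* Let J be the nilpotent residual of an A-algebra M, and let U be a subalgebra
   of minimal dimension with M = U + J.  For x in U the right multiplication R_x
   is a derivation, so its Fitting null component on U is a subalgebra, while
   its Fitting one component lies in J because some M^k does; by minimality R_x
   is nilpotent on U.  Engel's theorem makes U nilpotent, hence abelian, so that
   [M, M] is contained in [U, U] + J = J. *)

Set Implicit Arguments.
Unset Strict Implicit.
Unset Printing Implicit Defensive.

Import GRing.Theory.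
Local Open Scope ring_scope.

(** * Fitting decomposition of an endomorphism *)

Section Fitting.
Variables (F : fieldType) (L : vectType F).
Implicit Types (f : 'End(L)) (U : {vspace L}).

Definition lfun_iter f n : 'End(L) := iter n (comp_lfun f) \1%VF.

Lemma lfun_iterE f n v : lfun_iter f n v = iter n f v.
Proof. by elim: n => [|n IH]; rewrite /= ?id_lfunE // comp_lfunE IH. Qed.

Lemma iter_lfun_eq0 f n m v : (n <= m)%N -> iter n f v = 0 -> iter m f v = 0.
Proof.
move=> /subnK<- h; rewrite iterD h.
by elim: (m - n)%N => //= d ->; rewrite linear0.
Qed.

(** The kernels of the powers of [f] increase, with dimensions bounded by that of [L]; [n] is an
    exponent of maximal kernel dimension. *)
Lemma lker_iter_stable f :
  exists n, forall m v, iter m f v = 0 -> iter n f v = 0.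
Proof.
pose P d := `[< exists n, \dim (lker (lfun_iter f n)) = d >].
have exP : exists d, P d.
  by exists (\dim (lker (lfun_iter f 0))); apply/asboolP; exists 0%N.
have ubP d : P d -> (d <= \dim {:L})%N.
  by move=> /asboolP[n <-]; apply/dimvS/subvf.
case: (ex_maxnP exP ubP) => d /asboolP[n dn] dmax; exists n => m v fm.
have sub : (lker (lfun_iter f n) <= lker (lfun_iter f (maxn n m)))%VS.
  apply/subvP => w; rewrite !memv_ker !lfun_iterE => /eqP h.
  by rewrite (iter_lfun_eq0 _ h) // leq_maxl.
have E : lker (lfun_iter f n) = lker (lfun_iter f (maxn n m)).
  apply/eqP; rewrite eqEdim sub dn dmax //.
  by apply/asboolP; exists (maxn n m).
apply/eqP; rewrite -lfun_iterE -memv_ker E memv_ker lfun_iterE.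
by rewrite (iter_lfun_eq0 _ fm) // leq_maxr.
Qed.

Lemma fitting f U k : (forall u, u \in U -> f u \in U) ->
  exists2 n, (k <= n)%N & (forall m v, iter m f v = 0 -> iter n f v = 0) /\
    (U <= (U :&: lker (lfun_iter f n)) + lfun_iter f n @: U)%VS.
Proof.
move=> fU; have [n0 st0] := lker_iter_stable f.
(* Adding [k] lets the Fitting one component be pushed into a prescribed term of a lower central
   series. *)
pose n := (n0 + k)%N.
have st m v : iter m f v = 0 -> iter n f v = 0.
  by move=> /st0; apply: iter_lfun_eq0; apply: leq_addr.
exists n; [exact: leq_addl | split=> //].
set g := lfun_iter f n.
have gU : (g @: U <= U)%VS.
  apply/subvP => _ /memv_imgP[u Uu ->]; rewrite lfun_iterE.
  by elim: (n) => //= d; apply: fU.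
(* Stability of the kernels: f^(2n) u = 0 forces f^n u = 0. Rank-nullity then makes the direct sum
   fill [U]. *)
have cap0 : ((U :&: lker g) :&: (g @: U) = 0)%VS.
  apply/eqP; rewrite -subv0; apply/subvP => w.
  rewrite !memv_cap memv_ker => /andP[/andP[_ /eqP gw] /memv_imgP[u Uu wE]].
  move: gw; rewrite wE !lfun_iterE -iterD => /st ->; exact: mem0v.
suff /eqP -> : ((U :&: lker g) + g @: U == U)%VS by [].
rewrite eqEdim subv_add capvSl gU /=.
by rewrite dimv_disjoint_sum // limg_ker_dim.
Qed.

End Fitting.

Section Leibniz.
Variables (F : fieldType) (L : vectType F) (br : {bilinear L -> L -> L}).
Hypothesis brL : leibniz_identity br.
Implicit Types (A B J K M U V W : {vspace L}) (x y z u v w : L) (s t : seq L).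

(** * Right multiplications as derivations *)

Definition rmul z : 'End(L) := linfun (applyr br z).

Lemma rmulE z x : rmul z x = br x z.
Proof. by rewrite lfunE. Qed.

Lemma rmul_derivation z x y :
  rmul z (br x y) = br (rmul z x) y + br x (rmul z y).
Proof. by rewrite !rmulE brL addrC subrK. Qed.

(** In the Leibniz expansion each term multiplies R_z^p u by R_z^q v with p + q = a + b, so p >= a
    or q >= b. The double induction avoids binomial coefficients. *)
Lemma iter_rmul_br z a b u v : iter a (rmul z) u = 0 ->
  iter b (rmul z) v = 0 -> iter (a + b) (rmul z) (br u v) = 0.
Proof.
elim: a b u v => [|a IHa] b u v.
  by move=> u0 _; rewrite (u0 : u = 0) linear0l -lfun_iterE linear0.
elim: b v => [|b IHb] v ua vb.
  by rewrite (vb : v = 0) linear0r -lfun_iterE linear0.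
rewrite addSn iterSr rmul_derivation -lfun_iterE linearD /= !lfun_iterE.
rewrite IHa -?iterSr // add0r -addSnnS.
by apply: IHb; rewrite -?iterSr.
Qed.

(** * Left-normed products along words *)

Lemma foldl_brD s u v : foldl br (u + v) s = foldl br u s + foldl br v s.
Proof. by elim: s u v => //= b s IH u v; rewrite linearDl IH. Qed.

Lemma foldl_brN s u : foldl br (- u) s = - foldl br u s.
Proof. by elim: s u => //= b s IH u; rewrite linearNl IH. Qed.

Lemma foldl_br0 s : foldl br 0 s = 0.
Proof. by elim: s => //= b s IH; rewrite linear0l. Qed.

Lemma foldl_br_mem V A v s : (forall v a, v \in V -> a \in A -> br v a \in V) ->
  v \in V -> all [in A] s -> foldl br v s \in V.
Proof.
move=> VA; elim: s v => //= b s IH v Vv /andP[Ab As].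
by apply: IH => //; apply: VA.
Qed.

(** [W] is arbitrary so that the induction can replace it by its preimage under a right
    multiplication. *)
Lemma lcs_words M W k :
  (forall v s, v \in M -> all [in M] s -> size s = k -> foldl br v s \in W) ->
  (lcs br M k <= W)%VS.
Proof.
elim: k W => [|k IH] W h; first by apply/subvP => v Mv; apply: (h v [::]).
apply/brvP => u m ku Mm; rewrite -rmulE memv_preim.
apply: (subvP (IH _ _)) u ku => v s Mv Ms sk.
rewrite -memv_preim rmulE -[br _ m]/(foldl br _ [:: m]) -foldl_cat.
by apply: h; rewrite ?all_cat ?Ms /= ?Mm // size_cat sk addn1.
Qed.

(** By linearity a basis of [V] suffices, so the annihilator is a finite intersection of kernels. *)
Lemma annihilator_exists V A :
  exists K, forall a, a \in K <-> a \in A /\ forall v, v \in V -> br v a = 0.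
Proof.
exists (A :&: \bigcap_(i < \dim V) lker (linfun (br (vbasis V)`_i)))%VS => a.
rewrite memv_cap; split=> [/andP[Aa /subv_bigcapP h]|[Aa h]].
  split=> // v /coord_vbasis ->; rewrite linear_sumlz big1 // => i _.
  rewrite linearZl_LR; have := h i isT; rewrite -memvE memv_ker lfunE.
  by move/eqP => /= ->; rewrite scaler0.
rewrite Aa memvE; apply/subv_bigcapP => i _; rewrite -memvE memv_ker lfunE /=.
by rewrite h // vbasis_mem // mem_nth // size_tuple.
Qed.

(** * Nilpotent actions and Engel's theorem *)

Definition acts_nil V B k :=
  forall v s, v \in V -> all [in B] s -> size s = k -> foldl br v s = 0.

Lemma acts_nil_le V B k v s : acts_nil V B k -> v \in V -> all [in B] s ->
  (k <= size s)%N -> foldl br v s = 0.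
Proof.
move=> nB Vv; rewrite -{1 3}(cat_take_drop k s) all_cat => /andP[Bt _] ks.
by rewrite foldl_cat (nB v) ?foldl_br0 ?size_takel.
Qed.

(* Expanding v [..[a, b1] .., bm] by the Leibniz identity gives products of v by
   a and the b's in which at least k of the b's stand on the same side of a. *)
Lemma acts_nil_commutator V A B k :
  (forall v a, v \in V -> a \in A -> br v a \in V) -> (B <= A)%VS ->
  acts_nil V B k ->
  forall s s1 s2 a v, a \in A -> v \in V ->
    all [in B] s -> all [in B] s1 -> all [in B] s2 ->
    (k.*2 <= size s1 + size s2 + size s)%N ->
  foldl br (br (foldl br v s1) (foldl br a s)) s2 = 0.
Proof.
move=> VA sBA nB s; elim/last_ind: s => [|s b IH] s1 s2 a v Aa Vv.
  move=> _ B1 B2 /=; rewrite addn0 -addnn => le_k.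
  have [le1|lt1] := leqP k (size s1).
    by rewrite (acts_nil_le nB Vv B1 le1) linear0l foldl_br0.
  apply: (acts_nil_le nB _ B2).
    apply: (VA) => //; apply: (foldl_br_mem (A := B)) => // w c Vw Bc.
    by apply: VA => //; apply: (subvP sBA).
  by rewrite -(leq_add2l k) (leq_trans le_k) // leq_add2r ltnW.
rewrite all_rcons size_rcons => /andP[Bb Bs] B1 B2 le_k.
(* The last letter [b] of [s] moves to the front of [s2] or to the end of [s1]; the total length is
   unchanged. *)
rewrite foldl_rcons brL foldl_brD foldl_brN.
have -> : foldl br (br (br (foldl br v s1) (foldl br a s)) b) s2 = 0.
  apply: (IH s1 (b :: s2)) => //=; first by rewrite Bb.
  by rewrite addnS addSnnS.
rewrite -foldl_rcons (IH (rcons s1 b) s2) ?subr0 //.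
  by rewrite all_rcons Bb.
by rewrite size_rcons !addSn -addnS.
Qed.

(* On each factor of the filtration H_i = {v | v B^i = 0}, which a preserves, B
   acts as 0 and a is nilpotent. *)
Lemma acts_nil_addv_line V B a k n :
  (forall v b, v \in V -> b \in (B + <[a]>)%VS -> br v b \in V) ->
  (forall b, b \in B -> br a b \in B) ->
  (forall v, v \in V -> iter n (rmul a) v = 0) ->
  acts_nil V B k -> acts_nil V (B + <[a]>) (n * k).
Proof.
move=> VB' aB an nB.
have VB v b : v \in V -> b \in B -> br v b \in V.
  by move=> Vv Bb; apply: VB' => //; apply: (subvP (addvSl _ _)).
have Va v : v \in V -> br v a \in V.
  by move=> Vv; apply: VB' => //; apply: (subvP (addvSr _ _)); apply: memv_line.
pose H i v := v \in V /\
  forall s, all [in B] s -> size s = i -> foldl br v s = 0.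
have HD i u v : H i u -> H i v -> H i (u + v).
  move=> [Vu hu] [Vv hv]; split=> [|s Bs si]; first exact: rpredD.
  by rewrite foldl_brD hu ?hv ?addr0.
have HZ i c v : H i v -> H i (c *: v).
  move=> [Vv hv]; split=> [|s Bs si]; first exact: memvZ.
  suff -> : foldl br (c *: v) s = c *: foldl br v s by rewrite hv ?scaler0.
  by elim: s {Bs si} v {Vv hv} => //= b s IH v; rewrite linearZl_LR /= IH.
have HB i v b : H i.+1 v -> b \in B -> H i (br v b).
  move=> [Vv hv] Bb; split=> [|s Bs si]; first exact: VB.
  by apply: (hv (b :: s)); rewrite /= ?Bb ?si.
have HS i v : H i v -> H i.+1 v.
  move=> [Vv hv]; split=> // s Bs si.
  case/lastP: s Bs si => // s b; rewrite all_rcons size_rcons => /andP[_ Bs] [si].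
  by rewrite foldl_rcons hv // linear0l.
have Ha i v : H i v -> H i (br v a).
  elim: i v => [|i IH] v Hv; have [Vv hv] := Hv; split; try exact: Va.
    move=> s _ /size0nil ->; rewrite /= (_ : v = 0) ?linear0l //.
    exact: (hv [::]).
  case=> // b s /= /andP[Bb Bs] [si].
  have -> : br (br v a) b = br v (br a b) + br (br v b) a by rewrite brL subrK.
  rewrite foldl_brD (HB _ _ _ Hv (aB _ Bb)).2 // add0r.
  exact: (IH _ (HB _ _ _ Hv Bb)).2.
have HB' i v b : H i v -> b \in (B + <[a]>)%VS -> H i (br v b).
  move=> Hv /memv_addP[b1 Bb1 [_ /vlineP[c ->] ->]].
  rewrite linearDr linearZr_LR /=; apply: HD; last exact/HZ/Ha.
  by apply: HB => //; apply: HS.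
(* Modulo H_i, a letter b1 + e a acts on H_{i+1} as e R_a, so a word acts as a multiple of a power
   of R_a. *)
have step i v t : H i.+1 v -> all [in (B + <[a]>)%VS] t ->
    exists h c, H i h /\ foldl br v t = h + c *: iter (size t) (rmul a) v.
  move=> Hv; elim/last_ind: t => [_|t b IH].
    exists 0, 1; rewrite scale1r add0r; split=> //; split; first exact: mem0v.
    by move=> s _ _; rewrite foldl_br0.
  rewrite all_rcons => /andP[Bb /IH[h [c [Hh E]]]].
  have Hw : H i.+1 (iter (size t) (rmul a) v).
    by elim: (size t) => //= d IHd; rewrite rmulE; apply: Ha.
  rewrite foldl_rcons E linearDl /= size_rcons.
  case/memv_addP: (Bb) => [b1 Bb1 [_ /vlineP[e ->] bE]].
  exists (br h b + c *: br (iter (size t) (rmul a) v) b1), (c * e); split.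
    by apply: HD; [apply: HB' | apply/HZ/HB].
  rewrite {2}bE linearZl_LR linearDr linearZr_LR /= scalerDr scalerA addrA.
  by rewrite rmulE.
(* Since R_a^n = 0 on [V], every [n] letters descend one step of the filtration, from H_k = V down
   to H_0 = 0. *)
have nilH i v t : H i v -> all [in (B + <[a]>)%VS] t -> size t = (n * i)%N ->
    foldl br v t = 0.
  elim: i v t => [|i IH] v t Hv Bt.
    by rewrite muln0 => /size0nil ->; apply: (Hv.2 [::]).
  rewrite mulnS => st; move: Bt; rewrite -(cat_take_drop n t) all_cat foldl_cat.
  have szn : size (take n t) = n by rewrite size_takel // st leq_addr.
  move=> /andP[/(step _ _ _ Hv)[h [c [Hh ->]]] Bd].
  rewrite szn an ?Hv.1 // scaler0 addr0; apply: IH => //.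
  by rewrite size_drop st addKn.
by move=> v s Vv; apply: nilH; split=> // t; apply: nB.
Qed.

(** Among the subalgebras of [A] that act nilpotently on [V] and contain the annihilator [K], one of
    maximal dimension is [A]: otherwise it could be enlarged by a line. *)
Lemma engel V A : subalgebra br A ->
  (forall v a, v \in V -> a \in A -> br v a \in V) ->
  (forall a, a \in A ->
     exists n, forall v, v \in V -> iter n (rmul a) v = 0) ->
  exists k, acts_nil V A k.
Proof.
move=> sA VA nA; have [K KP] := annihilator_exists V A.
pose Q B := [/\ (K <= B)%VS, (B <= A)%VS, subalgebra br B &
                exists k, acts_nil V B k].
pose P d := `[< exists2 B, Q B & \dim B = d >].
have K_br x y : x \in A -> y \in K -> br x y \in K.
  move=> Ax /KP[Ay Vy]; apply/KP; split; first exact: sA.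
  by move=> v Vv; rewrite brL !Vy ?linear0l ?subr0 //; apply: VA.
have sKA : (K <= A)%VS by apply/subvP => a /KP[].
have exP : exists d, P d.
  exists (\dim K); apply/asboolP; exists K => //; split=> //.
    by move=> x y /(subvP sKA); apply: K_br.
  exists 1%N => v [|a [|]] //= Vv /andP[/KP[_ Va] _] _; exact: Va.
have ubP d : P d -> (d <= \dim {:L})%N.
  by move=> /asboolP[B _ <-]; apply/dimvS/subvf.
case: (ex_maxnP exP ubP) => d /asboolP[B [sKB sBA sB [k nB]] dB] dmax.
have [sAB|nsAB] := boolP (A <= B)%VS.
  exists k => v s Vv /allP As; apply: nB => //.
  by apply/allP => x /As; apply: (subvP sAB).
(* If no such a existed, there would be arbitrarily long products
   [..[a0, b1] .., bm] outside B; but the long ones annihilate V. *)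
have [a [Aa nBa aB]] : exists a, [/\ a \in A, a \notin B &
    forall b, b \in B -> br a b \in B].
  have [a0 Aa0 nBa0] : exists2 a, a \in A & a \notin B.
    apply: contrapT => h; case/negP: nsAB; apply/subvP => a Aa.
    by apply: contrapT => /negP nBa; apply: h; exists a.
  apply: contrapT => h.
  have word n : exists s, [/\ all [in B] s, size s = n & foldl br a0 s \notin B].
    elim: n => [|n [s [Bs sn nBs]]]; first by exists [::].
    apply: contrapT => h'; apply: h; exists (foldl br a0 s); split=> //.
      apply: (foldl_br_mem sA) => //.
      by apply/allP => x /(allP Bs); apply: (subvP sBA).
    move=> b Bb; apply: contrapT => /negP nb; apply: h'.
    by exists (rcons s b); rewrite all_rcons Bb size_rcons sn foldl_rcons.
  have [s [Bs sk /negP[]]] := word k.*2; apply: (subvP sKB); apply/KP; split.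
    apply: (foldl_br_mem sA) => //.
    by apply/allP => x /(allP Bs); apply: (subvP sBA).
  move=> v Vv; apply: (acts_nil_commutator VA sBA nB (s1 := [::]) (s2 := [::])) => //.
  by rewrite sk.
(* Right actions are antisymmetric in the bracket, so the failure of antisymmetry in [A] lies in
   [K], hence in [B]; thus [a] normalizes [B] on both sides. *)
have Ksym x y : x \in A -> y \in A -> br x y + br y x \in K.
  move=> Ax Ay; apply/KP; split; first by apply: rpredD; apply: sA.
  by move=> v Vv; rewrite linearDr /= !brL subrKA subrr.
have Ksq x : x \in A -> br x x \in K.
  by move=> Ax; apply/KP; split; [apply: sA | move=> v Vv; rewrite brL subrr].
have Ba b : b \in B -> br b a \in B.
  move=> Bb; rewrite -[br b a](addrK (br a b)); apply: rpredB; last exact: aB.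
  by apply: (subvP sKB); apply: Ksym => //; apply: (subvP sBA).
have sB'A : (B + <[a]> <= A)%VS by rewrite subv_add sBA -memvE.
have [n an] := nA a Aa.
have QB' : Q (B + <[a]>)%VS.
  split=> //; first exact: subv_trans sKB (addvSl _ _).
    move=> _ _ /memv_addP[x Bx [_ /vlineP[c ->] ->]]
      /memv_addP[y By [_ /vlineP[e ->] ->]].
    apply: (subvP (addvSl _ _)).
    rewrite linearDl !linearDr /= !linearZl_LR !linearZr_LR /=.
    have Baa : br a a \in B by apply: (subvP sKB); apply: Ksq.
    by do ?[apply: rpredD | apply: memvZ]; rewrite ?Baa //;
      [apply: sB | apply: Ba | apply: aB].
  exists (n * k)%N; apply: acts_nil_addv_line => // v b Vv /(subvP sB'A).
  exact: VA.
have /dmax : P (\dim (B + <[a]>)) by apply/asboolP; exists (B + <[a]>)%VS.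
rewrite leqNgt => /negP[]; rewrite -dB ltnNge; apply/negP => le.
case/negP: nBa; have /eqP -> : (B == B + <[a]>)%VS by rewrite eqEdim addvSl.
by apply: (subvP (addvSr _ _)); apply: memv_line.
Qed.

(** * Nilpotent supplement of the residual, and conclusion *)

Lemma nilpotent_supplement M J : subalgebra br M -> is_nilpotent_residual br M J ->
  exists U, [/\ subalgebra br U, nilpotent br U & (M <= U + J)%VS].
Proof.
move=> sM [iJ nJ _]; have [k kJ] := (nilpotent_quoP sM iJ).1 nJ.
pose Q U := [/\ (U <= M)%VS, subalgebra br U & (M <= U + J)%VS].
pose P d := `[< exists2 U, Q U & \dim U = d >].
have exP : exists d, P d.
  by exists (\dim M); apply/asboolP; exists M => //; split=> //; apply: addvSl.
case: (ex_minnP exP) => d /asboolP[U [sUM sU MUJ] dU] dmin.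
exists U; split=> //.
have nilU x : x \in U -> exists n, forall u, u \in U -> iter n (rmul x) u = 0.
  move=> Ux; have fU u : u \in U -> rmul x u \in U.
    by move=> Uu; rewrite rmulE; apply: sU.
  have [n kn [st sub]] := fitting k fU; exists n.
  set U0 := (U :&: lker (lfun_iter (rmul x) n))%VS in sub.
  have U0P u : u \in U0 -> u \in U /\ iter n (rmul x) u = 0.
    by rewrite memv_cap memv_ker lfun_iterE => /andP[Uu /eqP].
  have QU0 : Q U0.
    have sU0 : (U0 <= U)%VS by apply: capvSl.
    split; first exact: subv_trans sU0 sUM.
      move=> u v /U0P[Uu u0] /U0P[Uv v0].
      rewrite memv_cap sU //= memv_ker lfun_iterE.
      (* The derivation rule kills the product only after 2n steps; stability brings this back to
         [n]. *)
      by rewrite (st (n + n)%N) // iter_rmul_br.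
    apply: (subv_trans MUJ); rewrite subv_add addvSr andbT.
    apply: (subv_trans sub); apply: addvS => //.
    (* R_x^n maps [M] into [lcs br M n], which lies in [lcs br M k] since k <= n. *)
    apply/subvP => _ /memv_imgP[u Uu ->]; apply: (subvP kJ).
    apply: (subvP (lcs_decr sM kn)); rewrite lfun_iterE.
    elim: (n) => [|m IH]; first exact: (subvP sUM).
    by rewrite iterS rmulE; apply: memv_brv => //; apply: (subvP sUM).
  have /eqP E : U0 == U.
    by rewrite eqEdim capvSl dU dmin //; apply/asboolP; exists U0.
  by move=> u; rewrite -{1}E => /U0P[].
have [m nm] := engel sU sU nilU; exists m; apply/eqP; rewrite -subv0.
by apply: lcs_words => v s Uv Us sm; rewrite memv0; apply/eqP/nm.
Qed.

Lemma nilpotent_residual_A_algebra M : A_algebra br -> subalgebra br M ->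
  nilpotent_residual br M = brv br M M.
Proof.
move=> hA sM; have RJ := nilpotent_residualP brL sM.
have [[sJM iJ] _ minJ] := RJ; set J := nilpotent_residual br M in RJ sJM iJ minJ *.
have i1 := lcs_ideal brL 1 sM.
apply/eqP; rewrite eqEsubv; apply/andP; split.
  (* [lcs br M 1] is [M, M], and the quotient by it is abelian, so it contains [J]. *)
  by apply: (minJ (lcs br M 1)) => //; apply/nilpotent_quoP => //; exists 1%N.
have [U [sU nU MUJ]] := nilpotent_supplement sM RJ.
apply/brvP => x y Mx My.
case/memv_addP: (subvP MUJ _ Mx) => u Uu [j Jj xE].
case/memv_addP: (subvP MUJ _ My) => v Uv [l Jl yE].
have Mu : u \in M by rewrite -(addrK j u) -xE rpredB // (subvP sJM).
(* Modulo the ideal [J], [x, y] is [u, v], which vanishes because [U] is nilpotent and hence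
   abelian. *)
rewrite xE linearDl /= rpredD //; last exact: (iJ y j My Jj).2.
by rewrite yE linearDr /= (hA U) // add0r (iJ u l Mu Jl).1.
Qed.

End Leibniz.

Theorem lemma2p4 (F : fieldType) (L : vectType F)
    (br : {bilinear L -> L -> L}) (hbr : leibniz_identity br)
    (hA : A_algebra br) (i : nat) :
  lower_nilpotent_series br i = derived_series br fullv i.
Proof.
(* The induction hypothesis replaces L^(i) by the subalgebra N_i, leaving the residual of N_i to be
   compared with [N_i, N_i]. *)
elim: i => //= i <-; apply: nilpotent_residual_A_algebra => //.
exact: lower_nilpotent_series_subalgebra.
Qed.
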